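(* There exist an absolute constant $c>0$, a strictly increasing sequence of positive integers $(n_j)_{j\ge 1}$, and for each $j$ a $6$-permutation family $([n_j],\mathcal A_j)$ on $n_j$ vertices such that $$\operatorname{disc}_2([n_j],\mathcal A_j)\ \ge\ c\sqrt{\log n_j}\qquad\text{for all } j\ge 1.$$ That is, there is a sequence of $6$-permutation families on $n$ vertices with root-mean-squared discrepancy $\Omega(\sqrt{\log n})$.
   Context: A set system $(\Omega,\mathcal A)$ consists of a finite set $\Omega$ and a finite collection $\mathcal A$ of subsets of $\Omega$, possibly with multiplicity (a multiset); $|\mathcal A|$ counts members with multiplicity. Write $[n]=\{1,\dots,n\}$. A permutation $\sigma:[n]\to[n]$ determines the collection $\mathcal A_\sigma=\{\emptyset,\{\sigma(1)\},\{\sigma(1),\sigma(2)\},\dots,[n]\}$ ($n+1$ sets). A $k$-permutation family on $n$ vertices is a set system $([n],\mathcal A_{\sigma_1}+\dots+\mathcal A_{\sigma_k})$, where $\sigma_1,\dots,\sigma_k$ are permutations of $[n]$ and $+$ denotes multiset sum (union with multiplicity). For $\chi:\Omega\to\{+1,-1\}$ and $S\subseteq\Omega$ put $\chi(S)=\sum_{x\in S}\chi(x)$. The root-mean-squared discrepancy is $$\operatorname{disc}_2(\Omega,\mathcal A)=\min_{\chi:\Omega\to\{\pm1\}}\sqrt{\frac1{|\mathcal A|}\sum_{S\in\mathcal A}|\chi(S)|^2},$$ where the sum is over members of $\mathcal A$ with multiplicity. *)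

(* Defs.v *)
From HB Require Import structures.
From mathcomp Require Import all_boot all_order all_fingroup all_algebra.
From mathcomp Require Import reals exp.

Set Implicit Arguments.
Unset Strict Implicit.
Unset Printing Implicit Defensive.

Import Order.TTheory GRing.Theory Num.Theory.
Local Open Scope ring_scope.

(* A multiset of subsets of T is a list of sets, repetitions allowed; the
   order of the list is irrelevant to everything below. *)
Definition set_system (T : finType) := seq {set T}.

(* The ground set [n] is 'I_n, so s(1), ..., s(k) are the s i with i < k. *)
Definition prefix_set (n : nat) (s : 'S_n) (k : nat) : {set 'I_n} :=
  [set s i | i : 'I_n & (i < k)%N].

Definition prefix_system (n : nat) (s : 'S_n) : set_system 'I_n :=
  [seq prefix_set s k | k <- iota 0 n.+1].

Definition permutation_family (k n : nat) (A : set_system 'I_n) : Prop :=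
  exists s : k.-tuple 'S_n, perm_eq A (flatten [seq prefix_system t | t <- s]).

(* A colouring with values in {+1, -1} is encoded by booleans, which makes the
   type of colourings finite: false stands for +1 and true for -1. *)
Definition coloring (T : finType) := {ffun T -> bool}.

Definition color_sum (R : realType) (T : finType) (chi : coloring T)
    (S : {set T}) : R :=
  \sum_(x in S) (-1) ^+ chi x.

Definition rms (R : realType) (T : finType) (A : set_system T)
    (chi : coloring T) : R :=
  Num.sqrt ((size A)%:R^-1 * \sum_(S <- A) `|color_sum R chi S| ^+ 2).

(* The value at the constant colouring +1 only serves as the initial element
   of the iterated minimum, as a total order on R has no top element. *)
Definition disc2 (R : realType) (T : finType) (A : set_system T) : R :=
  \big[Num.min/rms R A [ffun=> false]]_(chi : coloring T) rms R A chi.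

(* Main.v *)
Require Import Defs.
From HB Require Import structures.
From mathcomp Require Import all_boot all_order all_fingroup all_algebra.
From mathcomp Require Import reals exp.
From mathcomp Require Import zify ring lra.

Set Implicit Arguments.
Unset Strict Implicit.
Unset Printing Implicit Defensive.

Import Order.TTheory GRing.Theory Num.Theory.
Local Open Scope ring_scope.

(** Identify the 3 ^ k points with words of length k over {0, 1, 2} and take the
    lexicographic order for the digit orders 012, 120 and 201; each of these
    three permutations is used twice.

    Fix a colouring.  For a point x and an order r, let h_r(x) be the mean of
    the colour sums of the two prefixes that end just before and just after x.
    By convexity, the sum of the h_r(x) ^ 2 over x is at most the sum of the
    squared colour sums of the prefixes of the order r (midpoint_energy_le), so
    it suffices to bound the energy, that is, the sum of all h_r(x) ^ 2.

    Consider a block of 3 ^ (k+1) points with colour sum d, cut by the leading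
    digit into three blocks with sums e_0, e_1, e_2.  Summing over the three
    cyclic orders the colours that precede the block c gives
    e_(c+1) + 2 e_(c+2), for indices mod 3.  Two things follow.
    - By induction, the averages m_r of h_r over the block satisfy
      m_0 + m_1 + m_2 = 3/2 d.
    - The averages of h_r over the three subblocks, summed over r, differ from
      3/2 d by (e_(c+2) - e_(c+1)) / 2.  So if the e_c are not all equal, the
      averages over subblocks vary for some order r, and the variation
      contributes to the variance of h_r over the block.
    If the e_c are equal, then d ^ 2 is nine times the mean of the e_c ^ 2:
    the colour sums grow.  Using - d ^ 2 / 36 as a potential, each of the k
    levels gains 2/9 per point, because every block has odd size and hence
    e_c ^ 2 >= 1 (cyclic_lex_energy_shift).  At the top the potential is
    compensated by the squared means m_r ^ 2, whose sum is at least 3/4 d ^ 2.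
    The energy is thus at least 2/9 k 3 ^ k (cyclic_lex_energy), which makes
    the mean square of the colour sums of order k, while
    ln (3 ^ k) = k ln 3. *)

(** * Energy of a sequence *)

(** The sum of the squared midpoints of consecutive partial sums of u, the
    partial sums being shifted by t.  A midpoint counts its own entry with
    weight 1/2; this makes the average midpoints of the three orders below add
    up to exactly 3/2 of the total, without a boundary term. *)
Fixpoint midpoint_energy (R : realFieldType) (t : R) (u : seq R) : R :=
  if u is y :: u' then (t + y / 2) ^+ 2 + midpoint_energy (t + y) u' else 0.

Lemma midpoint_energy_cat (R : realFieldType) (t : R) (u v : seq R) :
  midpoint_energy t (u ++ v) =
  midpoint_energy t u + midpoint_energy (t + \sum_(y <- u) y) v.
Proof.
elim: u t => [|y u IHu] t /=; first by rewrite big_nil addr0 add0r.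
by rewrite IHu big_cons !addrA.
Qed.

(** By convexity, the square of a midpoint is at most the mean of the squares of
    its two ends.  An interior partial sum serves two midpoints and the first
    one only one; the unused half of its square carries the induction. *)
Lemma midpoint_energy_le (R : realFieldType) (t : R) (u : seq R) :
  t ^+ 2 / 2 + midpoint_energy t u <=
  \sum_(0 <= k < (size u).+1) (t + \sum_(y <- take k u) y) ^+ 2.
Proof.
elim: u t => [|y u IHu] t /=.
  by rewrite big_nat1 big_nil !addr0; nra.
rewrite big_nat_recl //= big_nil addr0.
under eq_bigr => k _ do rewrite big_cons addrA.
have := IHu (t + y).
have : 0 <= y ^+ 2 by exact: sqr_ge0.
by move: (midpoint_energy _ u) (\sum_(0 <= _ < _) _) => e p; nra.
Qed.

(** * The cyclic lexicographic orders *)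

Fixpoint cyclic_lex (r k : nat) : seq nat :=
  if k is k'.+1 then
    flatten [seq [seq (c * 3 ^ k' + y)%N | y <- cyclic_lex r k']
            | c <- rot r (iota 0 3)]
  else [:: 0%N].

Lemma perm_cyclic_lex (r k : nat) :
  perm_eq (cyclic_lex r k) (iota 0 (3 ^ k)).
Proof.
elim: k => [|k IHk]; first by [].
apply: (@perm_trans _ (flatten [seq [seq (c * 3 ^ k + y)%N
    | y <- cyclic_lex r k] | c <- iota 0 3])).
  by apply: perm_flatten; apply: perm_map; rewrite perm_rot.
have -> : iota 0 (3 ^ k.+1) =
    flatten [seq [seq (c * 3 ^ k + y)%N | y <- iota 0 (3 ^ k)] | c <- iota 0 3].
  by rewrite /= -!iotaDl cats0 !addn0 expnS !mulSn mul0n addn0 !iotaD !add0n.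
by rewrite /= !cats0; do !apply: perm_cat; apply: perm_map.
Qed.

Lemma size_cyclic_lex (r k : nat) : size (cyclic_lex r k) = (3 ^ k)%N.
Proof. by rewrite (perm_size (perm_cyclic_lex r k)) size_iota. Qed.

Definition signs (R : realFieldType) (chi : nat -> bool) (s : seq nat) : seq R :=
  [seq (-1) ^+ chi y | y <- s].

(** An odd number of signs has an odd sum, so the sum cannot vanish. *)
Lemma sum_signs_odd_sqr_ge1 (R : realFieldType) (chi : nat -> bool)
    (s : seq nat) :
  odd (size s) -> 1 <= (\sum_(y <- signs R chi s) y) ^+ 2.
Proof.
move=> odd_s.
have -> : \sum_(y <- signs R chi s) y = (size s)%:R - 2 * (count chi s)%:R.
  elim: s {odd_s} => [|y s IHs] /=; first by rewrite big_nil mulr0 subr0.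
  rewrite big_cons {}IHs natrD -natr1; case: (chi y) => /=.
    by rewrite expr1; ring.
  by rewrite expr0; ring.
case: (ltngtP (size s) (2 * count chi s)) => [|| eq_s].
- by rewrite -(ler_nat R) -natr1 natrM => h; nra.
- by rewrite -(ler_nat R) -natr1 natrM => h; nra.
by move: odd_s; rewrite eq_s mul2n odd_double.
Qed.

Lemma sum_signs_cyclic_lex (R : realFieldType) (chi : nat -> bool) (r k : nat) :
  \sum_(y <- signs R chi (cyclic_lex r k)) y =
  \sum_(y <- signs R chi (iota 0 (3 ^ k))) y.
Proof. by apply: perm_big; apply: perm_map; apply: perm_cyclic_lex. Qed.

Lemma signs_cyclic_lexS (R : realFieldType) (chi : nat -> bool) (r k : nat) :
  signs R chi (cyclic_lex r k.+1) =
  flatten [seq signs R (fun y => chi (c * 3 ^ k + y)%N) (cyclic_lex r k)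
          | c <- rot r (iota 0 3)].
Proof.
rewrite /signs /= map_flatten -map_comp; congr flatten.
by apply: eq_map => c /=; rewrite -map_comp.
Qed.

(** * The variance gained at one level of the recursion *)

Lemma cauchy3 (R : realFieldType) (x y z : R) :
  (x + y + z) ^+ 2 / 3 <= x ^+ 2 + y ^+ 2 + z ^+ 2.
Proof.
have := sqr_ge0 (x - y); have := sqr_ge0 (y - z); have := sqr_ge0 (x - z).
nra.
Qed.

Lemma sum_sqr_mean3 (R : realFieldType) (t x y z : R) :
  (t + x) ^+ 2 + (t + y) ^+ 2 + (t + z) ^+ 2 =
  3 * (t + (x + y + z) / 3) ^+ 2
  + ((x - (x + y + z) / 3) ^+ 2 + (y - (x + y + z) / 3) ^+ 2
     + (z - (x + y + z) / 3) ^+ 2).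
Proof. by field. Qed.

(** The gain of variance at one level.  Here x_r, y_r, z_r are the averages for
    the order r of the midpoints over the subblocks 0, 1, 2, whose sums are e0,
    e1, e2.  The variance identity splits the triple of each order r into its mean
    and its deviations; only the sum over r of the deviations of one subblock is known,
    and the Cauchy-Schwarz inequality bounds their squares by it. *)
Lemma cyclic_spread (R : realFieldType) (d e0 e1 e2 : R)
    (x0 x1 x2 y0 y1 y2 z0 z1 z2 t0 t1 t2 : R) :
  x0 + x1 + x2 = 3 / 2 * d + (e2 - e1) / 2 ->
  y0 + y1 + y2 = 3 / 2 * d + (e0 - e2) / 2 ->
  z0 + z1 + z2 = 3 / 2 * d + (e1 - e0) / 2 ->
  3 * ((t0 + (x0 + y0 + z0) / 3) ^+ 2 + (t1 + (x1 + y1 + z1) / 3) ^+ 2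
       + (t2 + (x2 + y2 + z2) / 3) ^+ 2)
  + (e0 ^+ 2 + e1 ^+ 2 + e2 ^+ 2) / 4 - (e0 + e1 + e2) ^+ 2 / 12 <=
  ((t0 + x0) ^+ 2 + (t1 + x1) ^+ 2 + (t2 + x2) ^+ 2)
  + ((t0 + y0) ^+ 2 + (t1 + y1) ^+ 2 + (t2 + y2) ^+ 2)
  + ((t0 + z0) ^+ 2 + (t1 + z1) ^+ 2 + (t2 + z2) ^+ 2).
Proof.
move=> xE yE zE.
set m0 := (x0 + y0 + z0) / 3; set m1 := (x1 + y1 + z1) / 3.
set m2 := (x2 + y2 + z2) / 3.
have mE : m0 + m1 + m2 = 3 / 2 * d by rewrite /m0 /m1 /m2; lra.
have hx := cauchy3 (x0 - m0) (x1 - m1) (x2 - m2).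
have hy := cauchy3 (y0 - m0) (y1 - m1) (y2 - m2).
have hz := cauchy3 (z0 - m0) (z1 - m1) (z2 - m2).
rewrite (_ : x0 - m0 + (x1 - m1) + (x2 - m2) = (e2 - e1) / 2) in hx; last by lra.
rewrite (_ : y0 - m0 + (y1 - m1) + (y2 - m2) = (e0 - e2) / 2) in hy; last by lra.
rewrite (_ : z0 - m0 + (z1 - m1) + (z2 - m2) = (e1 - e0) / 2) in hz; last by lra.
have s0 := sum_sqr_mean3 t0 x0 y0 z0.
have s1 := sum_sqr_mean3 t1 x1 y1 z1.
have s2 := sum_sqr_mean3 t2 x2 y2 z2.
rewrite -/m0 -/m1 -/m2 in s0 s1 s2.
have -> : (e0 ^+ 2 + e1 ^+ 2 + e2 ^+ 2) / 4 =
  (e0 + e1 + e2) ^+ 2 / 12 + (((e2 - e1) / 2) ^+ 2 + ((e0 - e2) / 2) ^+ 2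
     + ((e1 - e0) / 2) ^+ 2) / 3 by field.
by lra.
Qed.

(** * The energy of the three orders *)

(** The induction on levels.  The witness m_r is the average midpoint of the
    order r.  The shifts t_r are arbitrary because inside a block the three
    orders start from three different partial sums, according to the blocks
    that precede it; the bound is the variance plus the squared shifted means.
    The term - d ^ 2 / 36 is the potential: with the coefficient 1/36 the terms
    in d ^ 2 cancel between two levels, and (1/4 - 1/36) of e_c ^ 2 >= 1 remains
    for each of the three subblocks, that is, a gain of 3 * 2/9. *)
Lemma cyclic_lex_energy_shift (R : realFieldType) (k : nat) (chi : nat -> bool) :
  let u r := signs R chi (cyclic_lex r k) in
  let d := \sum_(y <- signs R chi (iota 0 (3 ^ k))) y in
  exists m0 m1 m2 : R,
    m0 + m1 + m2 = 3 / 2 * d /\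
    forall t0 t1 t2 : R,
      3 ^+ k * (2 / 9 * k%:R + 1 / 36 - d ^+ 2 / 36
                + ((t0 + m0) ^+ 2 + (t1 + m1) ^+ 2 + (t2 + m2) ^+ 2)) <=
      midpoint_energy t0 (u 0%N) + midpoint_energy t1 (u 1%N)
      + midpoint_energy t2 (u 2%N).
Proof.
elim: k chi => [|k IHk] chi u d.
  have dE : d = (-1) ^+ chi 0%N by rewrite /d /signs /= big_seq1.
  have d2 : d ^+ 2 = 1 by rewrite dE sqrr_sign.
  exists (d / 2), (d / 2), (d / 2); split; first by field.
  by move=> t0 t1 t2; rewrite /u /signs /= -dE expr0 d2; lra.
pose chi' c := fun y => chi (c * 3 ^ k + y)%N.
pose e c := \sum_(y <- signs R (chi' c) (iota 0 (3 ^ k))) y.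
have dE : d = e 0%N + e 1%N + e 2%N.
  rewrite /d -(sum_signs_cyclic_lex _ _ 0) signs_cyclic_lexS /= cats0 !big_cat /=.
  by rewrite !sum_signs_cyclic_lex addrA.
have e2 c : 1 <= e c ^+ 2.
  by apply: sum_signs_odd_sqr_ge1; rewrite size_iota oddX orbT.
case: (IHk (chi' 0%N)) => a0 [a1 [a2 [aE aP]]].
case: (IHk (chi' 1%N)) => b0 [b1 [b2 [bE bP]]].
case: (IHk (chi' 2%N)) => c0 [c1 [c2 [cE cP]]].
rewrite -/(e _) in aE aP; rewrite -/(e _) in bE bP; rewrite -/(e _) in cE cP.
(* The letters x, y, z stand for the subblocks 0, 1, 2 and the index for the
   order; each average is moved by the sums of the subblocks that come before
   in that order. *)
pose x0 := a0; pose y0 := e 0%N + b0; pose z0 := e 0%N + e 1%N + c0.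
pose y1 := b1; pose z1 := e 1%N + c1; pose x1 := e 1%N + e 2%N + a1.
pose z2 := c2; pose x2 := e 2%N + a2; pose y2 := e 2%N + e 0%N + b2.
exists ((x0 + y0 + z0) / 3), ((x1 + y1 + z1) / 3), ((x2 + y2 + z2) / 3).
have xE : x0 + x1 + x2 = 3 / 2 * d + (e 2%N - e 1%N) / 2.
  by move: aE; rewrite dE /x0 /x1 /x2; lra.
have yE : y0 + y1 + y2 = 3 / 2 * d + (e 0%N - e 2%N) / 2.
  by move: bE; rewrite dE /y0 /y1 /y2; lra.
have zE : z0 + z1 + z2 = 3 / 2 * d + (e 1%N - e 0%N) / 2.
  by move: cE; rewrite dE /z0 /z1 /z2; lra.
split; first by lra.
move=> t0 t1 t2.
have u0E t : midpoint_energy t (u 0%N) =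
    midpoint_energy t (signs R (chi' 0%N) (cyclic_lex 0 k))
    + midpoint_energy (t + e 0%N) (signs R (chi' 1%N) (cyclic_lex 0 k))
    + midpoint_energy (t + e 0%N + e 1%N) (signs R (chi' 2%N) (cyclic_lex 0 k)).
  rewrite /u signs_cyclic_lexS /= cats0 !midpoint_energy_cat.
  by rewrite !sum_signs_cyclic_lex !addrA.
have u1E t : midpoint_energy t (u 1%N) =
    midpoint_energy t (signs R (chi' 1%N) (cyclic_lex 1 k))
    + midpoint_energy (t + e 1%N) (signs R (chi' 2%N) (cyclic_lex 1 k))
    + midpoint_energy (t + e 1%N + e 2%N) (signs R (chi' 0%N) (cyclic_lex 1 k)).
  rewrite /u signs_cyclic_lexS /= cats0 !midpoint_energy_cat.
  by rewrite !sum_signs_cyclic_lex !addrA.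
have u2E t : midpoint_energy t (u 2%N) =
    midpoint_energy t (signs R (chi' 2%N) (cyclic_lex 2 k))
    + midpoint_energy (t + e 2%N) (signs R (chi' 0%N) (cyclic_lex 2 k))
    + midpoint_energy (t + e 2%N + e 0%N) (signs R (chi' 1%N) (cyclic_lex 2 k)).
  rewrite /u signs_cyclic_lexS /= cats0 !midpoint_energy_cat.
  by rewrite !sum_signs_cyclic_lex !addrA.
rewrite {}u0E {}u1E {}u2E.
have := aP t0 (t1 + e 1%N + e 2%N) (t2 + e 2%N).
have := bP (t0 + e 0%N) t1 (t2 + e 2%N + e 0%N).
have := cP (t0 + e 0%N + e 1%N) (t1 + e 1%N) t2.
move=> {}cP {}bP {}aP.
have := lerD (lerD aP bP) cP; rewrite -!mulrDr => {aP bP cP} IH.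
set E := (X in _ <= X) in IH; rewrite [leRHS](_ : _ = E); last by rewrite /E; ring.
apply: le_trans IH; clear E.
rewrite exprSr -mulrA; apply: ler_wpM2l; first exact: exprn_ge0.
have := cyclic_spread t0 t1 t2 xE yE zE.
have := e2 0%N; have := e2 1%N; have := e2 2%N.
rewrite dE -(natr1 k) /x0 /y0 /z0 /x1 /y1 /z1 /x2 /y2 /z2.
by move: (e 0%N) (e 1%N) (e 2%N) (k%:R) => *; lra.
Qed.

(** The squared means outweigh the potential: by the Cauchy-Schwarz inequality
    they add up to at least (3/2 d) ^ 2 / 3. *)
Lemma cyclic_lex_energy (R : realFieldType) (k : nat) (chi : nat -> bool) :
  3 ^+ k * (2 / 9 * k%:R) <=
  midpoint_energy 0 (signs R chi (cyclic_lex 0 k))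
  + midpoint_energy 0 (signs R chi (cyclic_lex 1 k))
  + midpoint_energy 0 (signs R chi (cyclic_lex 2 k)).
Proof.
have [m0 [m1 [m2 [mE mP]]]] := cyclic_lex_energy_shift R k chi.
apply: le_trans (mP 0 0 0); apply: ler_wpM2l; first exact: exprn_ge0.
rewrite !add0r; have := cauchy3 m0 m1 m2; rewrite mE.
set d := \sum_(y <- _) y; have := sqr_ge0 d; rewrite exprMn.
by move: (d ^+ 2) (m0 ^+ 2) (m1 ^+ 2) (m2 ^+ 2) => *; lra.
Qed.

(** * The permutation family *)

Lemma nth_cyclic_lex_lt (r k i : nat) :
  (i < 3 ^ k)%N -> (nth 0%N (cyclic_lex r k) i < 3 ^ k)%N.
Proof.
move=> lt_i; have := mem_nth 0%N (_ : (i < size (cyclic_lex r k))%N).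
rewrite size_cyclic_lex (perm_mem (perm_cyclic_lex r k)) mem_iota => h.
by have /andP[] := h lt_i.
Qed.

Definition lex_fun (r k : nat) (i : 'I_(3 ^ k)) : 'I_(3 ^ k) :=
  Ordinal (nth_cyclic_lex_lt r (ltn_ord i)).

Lemma lex_fun_inj (r k : nat) : injective (@lex_fun r k).
Proof.
move=> i j /(congr1 val) /= /eqP; rewrite nth_uniq ?size_cyclic_lex //.
  by move/eqP/val_inj.
by rewrite (perm_uniq (perm_cyclic_lex r k)) iota_uniq.
Qed.

Definition lex_perm (r k : nat) : 'S_(3 ^ k) := perm (@lex_fun_inj r k).

(** The recursion restricts colourings to blocks and translates them, which is
    painless for functions on nat; values outside the ground set are never
    read. *)
Definition nat_coloring (n : nat) (chi : coloring 'I_n) (y : nat) : bool :=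
  oapp chi false (insub y).

Lemma nat_coloringE (n : nat) (chi : coloring 'I_n) (i : 'I_n) :
  nat_coloring chi i = chi i.
Proof. by rewrite /nat_coloring valK. Qed.

Lemma color_sum_lex_prefix (R : realType) (r k m : nat)
    (chi : coloring 'I_(3 ^ k)) :
  (m <= 3 ^ k)%N ->
  color_sum R chi (prefix_set (lex_perm r k) m) =
  \sum_(y <- take m (signs R (nat_coloring chi) (cyclic_lex r k))) y.
Proof.
move=> le_m.
rewrite /color_sum /prefix_set big_imset /=; last by move=> i j _ _ /perm_inj.
rewrite /signs -map_take big_map (big_nth 0%N) size_take size_cyclic_lex.
have -> : (if (m < 3 ^ k)%N then m else (3 ^ k)%N) = m.
  by case: ltngtP le_m => // ->.
rewrite big_mkord (big_ord_widen _ (fun i => (-1) ^+ nat_coloring chi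
  (nth 0%N (take m (cyclic_lex r k)) i)) le_m).
by apply: eq_big => i; rewrite ?inE // => lt_i; rewrite nth_take // permE
  -nat_coloringE.
Qed.

Lemma lex_prefix_system_energy (R : realType) (r k : nat)
    (chi : coloring 'I_(3 ^ k)) :
  midpoint_energy 0 (signs R (nat_coloring chi) (cyclic_lex r k)) <=
  \sum_(S <- prefix_system (lex_perm r k)) `|color_sum R chi S| ^+ 2.
Proof.
have := midpoint_energy_le 0 (signs R (nat_coloring chi) (cyclic_lex r k)).
rewrite expr0n /= mul0r add0r => /le_trans; apply.
rewrite size_map size_cyclic_lex /prefix_system big_map.
have -> : iota 0 (3 ^ k).+1 = index_iota 0 (3 ^ k).+1 by rewrite /index_iota subn0.
rewrite big_nat [leRHS]big_nat le_eqVlt; apply/orP; left; apply/eqP.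
apply: eq_bigr => m /andP[_ lt_m].
rewrite add0r color_sum_lex_prefix //.
by rewrite real_normK // num_real.
Qed.

Definition cyclic_family (k : nat) : set_system 'I_(3 ^ k) :=
  flatten [seq prefix_system (lex_perm r k) | r <- [:: 0; 1; 2; 0; 1; 2]%N].

Lemma permutation_family_cyclic (k : nat) :
  permutation_family 6 (cyclic_family k).
Proof. by exists [tuple of [seq lex_perm r k | r <- [:: 0; 1; 2; 0; 1; 2]%N]]. Qed.

(** Doubling 2/9 k 3 ^ k and dividing by the 6 (3 ^ k + 1) prefixes leaves at
    least k / 27, as 3 ^ k + 1 <= 2 * 3 ^ k. *)
Lemma rms_cyclic_family (R : realType) (k : nat) (chi : coloring 'I_(3 ^ k)) :
  Num.sqrt (k%:R / 27) <= rms R (cyclic_family k) chi.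
Proof.
apply: ler_wsqrtr.
have sizeE : size (cyclic_family k) = (6 * (3 ^ k).+1)%N.
  by rewrite size_flatten /shape -map_comp /= !size_map size_iota /=; lia.
pose u r := signs R (nat_coloring chi) (cyclic_lex r k).
pose P r := \sum_(S <- prefix_system (lex_perm r k)) `|color_sum R chi S| ^+ 2.
have uP r : midpoint_energy 0 (u r) <= P r := lex_prefix_system_energy R r chi.
have e := cyclic_lex_energy R k (nat_coloring chi).
rewrite -!/(u _) in e; rewrite {}sizeE big_flatten big_map [leRHS]mulrC.
rewrite (eq_bigr P) // ler_pdivlMr ?ltr0n ?muln_gt0 //.
clearbody P; rewrite !big_cons big_nil /= addr0 natrM -(natr1 (3 ^ k)) natrX.
have : 1 <= (3 : R) ^+ k by apply: exprn_ege1; lra.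
move: e; have := uP 0%N; have := uP 1%N; have := uP 2%N; have := ler0n R k.
move: (k%:R) (3 ^+ k) => x N x0 u2 u1 u0 e N1.
have : x <= N * x by nra.
lra.
Qed.

Theorem theorem1p4 (R : realType) :
  exists (c : R) (n : nat -> nat) (A : forall j : nat, set_system 'I_(n j)),
    [/\ 0 < c,
        forall j : nat, (0 < n j)%N,
        forall i j : nat, (i < j)%N -> (n i < n j)%N,
        forall j : nat, permutation_family 6 (A j)
      & forall j : nat, c * Num.sqrt (ln (n j)%:R) <= disc2 R (A j)].
Proof.
exists (Num.sqrt (1 / 54)), (fun j => 3 ^ j)%N, cyclic_family; split.
- by rewrite sqrtr_gt0; lra.
- by move=> j; rewrite expn_gt0.
- by move=> i j; rewrite ltn_exp2l.
- exact: permutation_family_cyclic.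
move=> j; have le_rms chi : Num.sqrt (1 / 54) * Num.sqrt (ln (3 ^ j)%:R) <=
    rms R (cyclic_family j) chi.
  apply: le_trans (rms_cyclic_family R chi).
  rewrite -sqrtrM; last by lra.
  apply: ler_wsqrtr; rewrite natrX lnXn; last by lra.
  have : ln (3 : R) <= 2.
    by rewrite (_ : 3 = 1 + 2); [apply: le_ln1Dx; lra | lra].
  rewrite -[ln _ *+ _]mulr_natr; have := ler0n R j.
  by move: (ln _) (j%:R) => *; nra.
by apply: le_bigmin.
Qed.
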